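(* Let $(M,\nabla)$ be an affine manifold and let $g_0$ be a Hesse-Einstein metric on $M$. Then there exists a Koszul soliton $(M,g(t))$ with $g(0)=g_0$.
   Context: An affine manifold (also called flat manifold) $(M,\nabla)$ is a smooth manifold with a connection $\nabla$ whose torsion and curvature vanish. Around every point there are affine coordinate systems $\{x^1,\dots,x^n\}$, i.e. local coordinates with $\nabla_{\partial/\partial x^i}\partial/\partial x^j=0$; coordinate changes between them are affine transformations. A map between affine manifolds is affine if it is an affine map in local affine coordinates. A Riemannian metric $g$ on $(M,\nabla)$ is Hessian if locally $g=\nabla d\varphi$, i.e. $g_{ij}=\partial^2\varphi/\partial x^i\partial x^j$ in affine coordinates, for some local function $\varphi$. The second Koszul form $\beta(g)$ of a Hessian metric $g$ is the symmetric bilinear form given in affine coordinates by $\beta_{ij}=\frac12\,\frac{\partial^2\log\det[g_{pq}]}{\partial x^i\partial x^j}$. A Hessian metric $g$ is Hesse-Einstein if $\beta(g)=\lambda g$ for some constant $\lambda\in\mathbb{R}$. The Hesse-Koszul flow starting at a Hessian metric $g_0$ is the evolution equation $\frac{\partial}{\partial t}g(t)=2\beta(g(t))$, $g(0)=g_0$, for a family of Hessian metrics $g(t)$ on $M$, $t$ in some time interval $[0,T)$, $0<T\le\infty$. A Koszul soliton $(M,g(t))$ is a solution of the Hesse-Koszul flow such that $g(t)=\sigma(t)\,\varphi_t^*g(0)$ for all $t$ in the time interval, where $\varphi_t:M\to M$ is a family of affine bijections, depending smoothly on $t$, with $\varphi_0=\mathrm{id}$, and $\sigma(t)$ is a smooth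 scale function with $\sigma(0)=1$. *)

(* Defs.v *)
From HB Require Import structures.
From mathcomp Require Import all_boot all_order all_algebra.
From mathcomp Require Import all_classical all_reals all_analysis.

Set Implicit Arguments.
Unset Strict Implicit.
Unset Printing Implicit Defensive.

Import Order.TTheory GRing.Theory Num.Theory.
Import numFieldNormedType.Exports.

Local Open Scope classical_set_scope.
Local Open Scope ring_scope.

Section Smooth.
Context {R : realType}.

Definition iter_derive {V W : normedModType R} (vs : seq V) (f : V -> W) :
  V -> W := foldr (fun v h => derive h ^~ v) f vs.

(* In finite dimension, C^oo on an open set means that all iterated
   directional derivatives exist and are continuous there. *)
Definition smooth_on_open {V W : normedModType R} (O : set V) (f : V -> W) :=
  forall (vs : seq V) (a : V), O a ->
    {for a, continuous (iter_derive vs f)} /\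
    (forall v, derivable (iter_derive vs f) a v).

(* On an arbitrary set (needed for time intervals [0,T[): local restrictions
   of smooth functions defined on open sets. *)
Definition smooth_on {V W : normedModType R} (A : set V) (f : V -> W) :=
  forall a, A a -> exists (O : set V) (F : V -> W),
    [/\ open O, O a, smooth_on_open O F & {in O `&` A, F =1 f}].

(* [f] is differentiable at [t] with derivative [l], as a function on [I]
   (one-sided at an endpoint of the interval [I]). *)
Definition has_derivative_within {W : normedModType R} (I : set R)
    (f : R -> W) (t : R) (l : W) :=
  (fun s => (s - t)^-1 *: (f s - f t)) @ within I t^' --> l.

End Smooth.

(* A chart is given by total functions, meaningful on [cdom] (for [cmap]) and
   on [cimg], the image of [cdom] (for [cinv]). *)
Record chart (R : realType) (n : nat) (M : topologicalType) := Chart {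
  cdom : set M;
  cmap : M -> 'rV[R]_n;
  cinv : 'rV[R]_n -> M;
  cdom_open : open cdom;
  cimg_open : open (cmap @` cdom);
  cmapK : {in cdom, cancel cmap cinv};
  cmap_continuous : {in cdom, continuous cmap};
  cinv_continuous : {in cmap @` cdom, continuous cinv} }.

Definition cimg (R : realType) (n : nat) (M : topologicalType)
  (x : chart R n M) : set 'rV[R]_n := cmap x @` cdom x.

Definition compatible (R : realType) (n : nat) (M : topologicalType)
    (x y : chart R n M) :=
  smooth_on (cmap x @` (cdom x `&` cdom y)) (cmap y \o cinv x) /\
  smooth_on (cmap y @` (cdom x `&` cdom y)) (cmap x \o cinv y).

Record smoothManifold (R : realType) (n : nat) := SmoothManifold {
  man_sort :> topologicalType;
  man_hausdorff : hausdorff_space man_sort;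
  man_second_countable : @second_countable man_sort;
  atlas : set (chart R n man_sort);
  atlas_cover : forall p : man_sort, exists2 x, atlas x & cdom x p;
  atlas_compatible : forall x y, atlas x -> atlas y -> compatible x y;
  atlas_maximal : forall z, (forall x, atlas x -> compatible x z) -> atlas z }.

Arguments atlas {R n} s.

Section Manifold.
Context {R : realType} {n : nat} {M : smoothManifold R n}.
Local Notation chart := (chart R n M).

(* The partial derivative of [f] with respect to the [i]-th coordinate of [x]. *)
Definition cpartial (x : chart) (i : 'I_n) (f : M -> R) (p : M) : R :=
  derive (f \o cinv x) (cmap x p) (delta_mx 0 i).

Definition smooth_fun (U : set M) (f : M -> R) :=
  forall x, atlas M x -> smooth_on (cmap x @` (U `&` cdom x)) (f \o cinv x).

(* A covariant 2-tensor field is encoded by its matrix of components in each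
   chart; only the values at charts [x] of the atlas and points of [cdom x] are
   meaningful. *)
Definition tensor2 := chart -> M -> 'M[R]_n.

Definition tensor2_eq (g h : tensor2) :=
  forall x p, atlas M x -> cdom x p -> g x p = h x p.

(* Entry (i, k) is d(y^k o phi)/dx^i. *)
Definition jacobian (x y : chart) (phi : M -> M) (p : M) : 'M[R]_n :=
  \matrix_(i, k) cpartial x i (fun q => cmap y (phi q) 0 k) p.

(* The components at [p] in the chart [x] of the pullback of [g] by [phi],
   computed with a chart [y] around [phi p]. *)
Definition pullback (x y : chart) (phi : M -> M) (g : tensor2) (p : M) :
    'M[R]_n :=
  jacobian x y phi p *m g y (phi p) *m (jacobian x y phi p)^T.

Definition is_tensor2 (g : tensor2) :=
  (forall x, atlas M x -> smooth_on (cimg x) (g x \o cinv x)) /\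
  (forall x y p, atlas M x -> atlas M y -> cdom x p -> cdom y p ->
     g x p = pullback x y id g p).

Definition is_symmetric (g : tensor2) :=
  forall x p, atlas M x -> cdom x p -> (g x p)^T = g x p.

Definition riemannian (g : tensor2) :=
  [/\ is_tensor2 g, is_symmetric g &
      forall x p (v : 'rV[R]_n), atlas M x -> cdom x p -> v != 0 ->
        0 < (v *m g x p *m v^T) 0 0].

End Manifold.

Arguments tensor2 {R n} M.

(* A connection is encoded by its Christoffel symbols,
   nabla_(d/dx^i) d/dx^j = \sum_k christoffel x p i j k d/dx^k. *)
Record connection (R : realType) (n : nat) (M : smoothManifold R n) :=
  Connection {
  christoffel : chart R n M -> M -> 'I_n -> 'I_n -> 'I_n -> R;
  christoffel_smooth : forall x i j k, atlas M x ->
    smooth_on (cimg x) (fun u => christoffel x (cinv x u) i j k);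
  christoffel_change : forall x y p i j k, atlas M x -> atlas M y ->
    cdom x p -> cdom y p ->
    \sum_m christoffel x p i j m * cpartial x m (fun q => cmap y q 0 k) p =
    cpartial x i (cpartial x j (fun q => cmap y q 0 k)) p +
    \sum_l \sum_m christoffel y p l m k *
      cpartial x i (fun q => cmap y q 0 l) p *
      cpartial x j (fun q => cmap y q 0 m) p }.

Section Affine.
Context {R : realType} {n : nat} {M : smoothManifold R n}.
Variable nabla : connection M.
Local Notation chart := (chart R n M).
Local Notation Gamma := (christoffel nabla).

(* The [k]-th component of T(d/dx^i, d/dx^j). *)
Definition torsion (x : chart) (p : M) (i j k : 'I_n) : R :=
  Gamma x p i j k - Gamma x p j i k.

(* The [l]-th component of R(d/dx^i, d/dx^j) d/dx^k. *)
Definition curvature (x : chart) (p : M) (i j k l : 'I_n) : R :=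
  cpartial x i (fun q => Gamma x q j k l) p -
  cpartial x j (fun q => Gamma x q i k l) p +
  \sum_m (Gamma x p j k m * Gamma x p i m l -
          Gamma x p i k m * Gamma x p j m l).

Definition flat_connection :=
  forall x p, atlas M x -> cdom x p ->
    (forall i j k, torsion x p i j k = 0) /\
    (forall i j k l, curvature x p i j k l = 0).

Definition affine_chart (x : chart) :=
  atlas M x /\ forall p i j k, cdom x p -> Gamma x p i j k = 0.

(* By the Frobenius theorem the affine charts of a flat connection cover [M],
   so that quantifying over all of them below is never vacuous. *)
Definition affine_map (f : M -> M) :=
  forall p x y, affine_chart x -> affine_chart y -> cdom x p -> cdom y (f p) ->
    exists (U : set M) (A : 'M[R]_n) (b : 'rV[R]_n),
      [/\ open U, U p, U `<=` cdom x `&` f @^-1` cdom y &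
          forall q, U q -> cmap y (f q) = cmap x q *m A + b].

(* The components of nabla d f. *)
Definition hess (f : M -> R) (x : chart) (p : M) : 'M[R]_n :=
  \matrix_(i, j) (cpartial x i (cpartial x j f) p -
                  \sum_k Gamma x p i j k * cpartial x k f p).

Definition hessian_metric (g : tensor2 M) :=
  riemannian g /\
  forall p, exists (U : set M) (f : M -> R),
    [/\ open U, U p, smooth_fun U f &
        forall x q, atlas M x -> U q -> cdom x q -> g x q = hess f x q].

(* [b] is the second Koszul form of [g]: the tensor whose components in affine
   coordinates are given by the formula below. *)
Definition second_koszul_form (g b : tensor2 M) :=
  [/\ is_tensor2 b, is_symmetric b &
      forall x p i j, affine_chart x -> cdom x p ->
        b x p i j =
        2^-1 * cpartial x i (cpartial x j (fun q => ln (\det (g x q)))) p].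

Definition hesse_einstein (g : tensor2 M) :=
  hessian_metric g /\
  exists lambda : R, second_koszul_form g (fun x p => lambda *: g x p).

Definition time_interval (T : \bar R) : set R :=
  [set t | 0 <= t /\ (t%:E < T)%E].

Definition hesse_koszul_flow (T : \bar R) (g0 : tensor2 M)
    (g : R -> tensor2 M) :=
  [/\ (0 < T)%E,
      forall t, time_interval T t -> hessian_metric (g t),
      tensor2_eq (g 0) g0 &
      forall t, time_interval T t -> exists2 b, second_koszul_form (g t) b &
        forall x p, atlas M x -> cdom x p ->
          has_derivative_within (time_interval T)
            (fun s => g s x p) t (2 *: b x p)].

(* Joint smoothness of (t, p) |-> phi t p on I x M. *)
Definition smooth_family (I : set R) (phi : R -> M -> M) :=
  {within I `*` setT, continuous (fun z : R * M => phi z.1 z.2)} /\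
  forall x y, atlas M x -> atlas M y ->
    smooth_on
      [set z : R * 'rV[R]_n |
        [/\ I z.1, cimg x z.2 & cdom y (phi z.1 (cinv x z.2))]]
      (fun z : R * 'rV[R]_n => cmap y (phi z.1 (cinv x z.2))).

Definition koszul_soliton (T : \bar R) (g : R -> tensor2 M) :=
  hesse_koszul_flow T (g 0) g /\
  exists (sigma : R -> R) (phi : R -> M -> M),
    [/\ smooth_on (time_interval T) sigma /\ sigma 0 = 1,
        smooth_family (time_interval T) phi /\ (forall p, phi 0 p = p),
        forall t, time_interval T t -> bijective (phi t) /\ affine_map (phi t) &
        forall t x y p, time_interval T t -> atlas M x -> atlas M y ->
          cdom x p -> cdom y (phi t p) ->
          g t x p = sigma t *: pullback x y (phi t) (g 0) p].

End Affine.

(* Main.v *)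
(* In affine coordinates beta(c g) = beta(g) for a constant c > 0, since
   log det is only shifted by n log c.  Hence, if beta(g0) = lambda g0, the
   metrics g(t) = (1 + 2 lambda t) g0 solve the flow as long as
   1 + 2 lambda t > 0, and they form a soliton with phi_t = id.  That the
   identity is an affine map means that changes of affine charts are affine:
   the transformation law of the Christoffel symbols makes their second partial
   derivatives vanish. *)
Require Import Defs.
From mathcomp Require Import all_boot all_order all_algebra.
From mathcomp Require Import all_classical all_reals all_analysis.

Set Implicit Arguments.
Unset Strict Implicit.
Unset Printing Implicit Defensive.

Import Order.TTheory GRing.Theory Num.Theory.
Import numFieldNormedType.Exports.

Local Open Scope classical_set_scope.
Local Open Scope ring_scope.

(** * Smoothness under scaling, for affine functions and along projections *)

Lemma derivable_scale (R : realType) (V W : normedModType R) (c : R)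
    (f : V -> W) (a v : V) :
  derivable f a v -> derivable (fun u => c *: f u) a v.
Proof. exact: derivableZ. Qed.

(* No derivability is needed: for [c != 0] both limits fail to exist together,
   and the limit of a divergent filter in [R] is then [0] by convention. *)
Lemma derive_scale (R : realType) (V : normedModType R) (c : R)
    (f : V -> R) (a v : V) : c != 0 ->
  'D_v (fun u => c * f u) a = c * 'D_v f a.
Proof.
move=> c0; have [df|ndf] := pselect (derivable f a v); first exact: deriveZ.
have D0 (g : V -> R) : ~ derivable g a v -> 'D_v g a = 0.
  move=> ndg; have -> : 'D_v g a = point by apply: dvgP.
  by [].
rewrite (D0 f ndf) mulr0; apply: D0 => dcf; apply: ndf.
have := derivable_scale (c := c^-1) dcf.
have -> : (fun u => c^-1 *: (c * f u)) = f; last exact.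
by apply/funext => u; exact: mulKf.
Qed.

(** A derivative depends only on the germ of the function, so an equality on the open set [O]
    survives each further derivation. *)
Lemma iter_derive_scale (R : realType) (V W : normedModType R) (c : R)
    (O : set V) (f : V -> W) (vs : seq V) :
  open O -> smooth_on_open O f ->
  {in O, iter_derive vs (fun u => c *: f u) =1 fun u => c *: iter_derive vs f u}.
Proof.
move=> Oo fs; elim: vs => [//|v vs IH] a aO /=.
rewrite -deriveZ; last exact: (fs vs a (set_mem aO)).2.
apply: near_eq_derive.
have: \near a, O a by apply: open_nbhs_nbhs; split => //; exact: set_mem.
by apply: filterS => u Ou; apply: IH; exact: mem_set.
Qed.

Lemma smooth_on_scale (R : realType) (V W : normedModType R) (c : R)
    (A : set V) (f : V -> W) :
  smooth_on A f -> smooth_on A (fun u => c *: f u).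
Proof.
move=> fsm a Aa; have [B [F [Bo Ba Fs FE]]] := fsm a Aa.
exists B, (fun u => c *: F u); split => //; last by move=> u /FE /= ->.
move=> vs b Bb; have [Fc Fd] := Fs vs b Bb.
have E : {near b, (fun u => c *: iter_derive vs F u) =1
           iter_derive vs (fun u => c *: F u)}.
  have: \near b, B b by exact: open_nbhs_nbhs.
  apply: filterS => u Bu; rewrite (iter_derive_scale c vs Bo Fs)//; exact: mem_set.
split=> [|v]; last first.
  by apply: (near_eq_derivable E); exact: derivable_scale.
rewrite /prop_for /continuous_at (iter_derive_scale c vs Bo Fs (mem_set Bb)).
apply: cvg_trans (cvgZl_tmp (k:=c) Fc).
exact: near_eq_cvg E.
Qed.

(** Affine functions are closed under derivation (the new slope is 0), so the induction needs no
    case distinction on the length of [vs]. *)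
Lemma iter_derive_affine (R : realType) (a b : R) (vs : seq R) :
  exists a' b', iter_derive vs (fun s => b + a * s) = fun s => b' + a' * s.
Proof.
elim: vs => [|v vs [a' [b' E]]] /=; first by exists a, b.
exists 0, (a' * v); rewrite E; apply/funext => s.
rewrite mul0r addr0.
have H : is_derive s v (fun s : R => b' + a' * s) (0 + a' *: v).
  exact: is_deriveD.
by rewrite derive_val add0r.
Qed.

Lemma smooth_on_affine (R : realType) (a b : R) (A : set R) :
  smooth_on A (fun s => b + a * s).
Proof.
move=> t _; exists setT, (fun s => b + a * s); split=> //; first exact: openT.
move=> vs s _; have [a' [b' ->]] := iter_derive_affine a b vs.
have D v : derivable (fun s : R => b' + a' * s) s v.
  by apply: derivableD; [exact: derivable_cst | exact: derivable_scale].
split=> //.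
apply: differentiable_continuous; apply/derivable1_diffP; exact: D.
Qed.

Lemma iter_derive_snd (R : realType) (U V W : normedModType R) (f : V -> W)
    (vs : seq (U * V)) :
  iter_derive vs (f \o snd) = iter_derive (map snd vs) f \o snd.
Proof. by elim: vs => //= v vs ->. Qed.

(** Meant for families that do not depend on time, the first factor being the time axis. *)
Lemma smooth_on_snd (R : realType) (U V W : normedModType R) (A : set V)
    (B : set (U * V)) (f : V -> W) :
  B `<=` snd @^-1` A -> smooth_on A f -> smooth_on B (f \o snd).
Proof.
move=> BA fs z Bz; have [C [F [Co Cz Fs FE]]] := fs _ (BA _ Bz).
exists (snd @^-1` C), (F \o snd); split=> //.
- by apply: open_comp => // ? _; exact: cvg_snd.
- move=> vs u Cu; rewrite iter_derive_snd.
  have [Fc Fd] := Fs (map snd vs) _ Cu.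
  split=> [|v]; last exact: (Fd v.2).
  by apply: continuous_comp => //; exact: cvg_snd.
- move=> u /set_mem[Cu Bu]; apply: FE; apply/mem_set; split => //; exact: BA.
Qed.

(** * Positivity of the determinant of a positive definite matrix *)

Lemma posdef_det_gt0 (R : realType) (n : nat) (A : 'M[R]_n) :
  (forall v : 'rV[R]_n, v != 0 -> 0 < (v *m A *m v^T) 0 0) -> 0 < \det A.
Proof.
move=> Apos.
(* No matrix of the segment from [1] to [A] is singular, so [\det] keeps its
   sign along it. *)
pose p : {poly R} := \det (1%:M + 'X *: map_mx polyC (A - 1%:M)).
have pE s : p.[s] = \det (1%:M + s *: (A - 1%:M)).
  rewrite -[LHS]/(horner_eval s p) -det_map_mx; congr (\det _).
  apply/matrixP => i j; rewrite !mxE [LHS]horner_evalE.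
  rewrite hornerD hornerM hornerX hornerC hornerMn hornerC.
  by [].
have p0 : p.[0] = 1 by rewrite pE scale0r addr0 det1.
have p1 : p.[1] = \det A by rewrite pE scale1r addrC subrK.
rewrite ltNge; apply/negP => A0.
(* The intermediate value theorem is applied to [- p], which climbs from -1 to [- \det A >= 0]. *)
have [||s s01 /rootP] := @poly_ivt R (- p) 0 1; rewrite ?ler01 ?hornerN ?p0 ?p1//.
  by rewrite oppr_le0 ler01 oppr_ge0.
move/eqP; rewrite oppr_eq0 pE => /eqP/eqP/det0P[v v0].
move=> /(congr1 (fun w => (w *m v^T) 0 0)) /eqP.
have /andP[s0 s1] : 0 <= s <= 1 by [].
have vv : 0 < (v *m v^T) 0 0.
  have [i vi] : exists i, v 0 i != 0.
    apply/existsP; apply: contraR v0 => /existsPn H; apply/eqP/rowP => i.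
    by rewrite mxE; have := H i; rewrite negbK => /eqP.
  rewrite mxE (bigD1 i)//= mxE ltr_wpDr//.
    by apply: sumr_ge0 => j _; rewrite mxE -expr2 sqr_ge0.
  by rewrite -expr2 exprn_even_gt0.
(* As a convex combination of [1] and [A], the singular matrix pairs with its kernel vector [v] to a
   positive number, which should be 0. *)
have -> : 1%:M + s *: (A - 1%:M) = (1 - s) *: 1%:M + s *: A.
  by rewrite scalerBr scalerBl scale1r addrAC -addrA.
rewrite mulmxDr mulmxDl -!scalemxAr -!scalemxAl mulmx1 mul0mx.
move: vv (Apos v v0); move: (v *m v^T) (v *m A *m v^T) => P Q P0 Q0.
rewrite !mxE; apply/negP; rewrite gt_eqF//.
have [->|sn0] := eqVneq s 0; first by rewrite mul0r addr0 subr0 mul1r.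
by rewrite ltr_wpDl// ?mulr_ge0 ?subr_ge0 ?(ltW P0)// mulr_gt0// lt_def sn0.
Qed.


(** * Functions with constant derivatives *)

Lemma affine_of_derive_const (R : realType) (phi : R -> R) (c r : R) :
  (forall t : R, `|t| < r -> is_derive t 1 phi c) ->
  forall t : R, `|t| < r -> phi t = phi 0 + t * c.
Proof.
move=> dphi.
(* This is the mean value theorem for an ordered pair; below, 0 is the left or the right end
   according to the sign of [t]. *)
have H (x y : R) : x <= y -> `|x| < r -> `|y| < r -> phi y - phi x = c * (y - x).
  move=> xy xr yr.
  have I z : z \in `[x, y]%R -> `|z| < r.
    rewrite in_itv /= => /andP[xz zy]; rewrite ltr_norml.
    move: xr yr; rewrite !ltr_norml => /andP[xr _] /andP[_ yr].
    by rewrite (lt_le_trans xr xz) (le_lt_trans zy yr).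
  have [z zxy||z _ //] := @MVT_segment R phi (fun=> c) x y xy.
    by apply: dphi; apply: I; exact: subset_itv_oo_cc.
  by apply: derivable_within_continuous => z /I/dphi [].
move=> t tr; have r0 : `|0 : R| < r by rewrite normr0 (le_lt_trans _ tr).
have [t0|/ltW t0] := leP 0 t.
  by have := H _ _ t0 r0 tr; rewrite subr0 mulrC => <-; rewrite addrC subrK.
have := H _ _ t0 tr r0; rewrite sub0r mulrN mulrC => /eqP.
by rewrite subr_eq addrC -subr_eq opprK => /eqP <-.
Qed.

(** The two difference quotients are the same function of [h]. *)
Lemma is_derive_line (R : realType) (V W : normedModType R) (f : V -> W)
    (a v : V) (t : R) (l : W) :
  is_derive (a + t *: v) v f l -> is_derive t 1 (fun s => f (a + s *: v)) l.
Proof.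
have E : (fun h : R => h^-1 *: (((fun s => f (a + s *: v)) \o shift t) (h *: 1)
                           - f (a + t *: v))) =
         (fun h => h^-1 *: ((f \o shift (a + t *: v)) (h *: v)
                           - f (a + t *: v))).
  apply/funext => h; congr (_ *: (f _ - _)) => /=.
  by rewrite [h *: 1]mulr1 scalerDl addrCA.
by move=> [df dl]; split; rewrite /derivable /derive E.
Qed.

(* Balls of ['rV_n] are cubes, so the increment from [a] to [u] splits into
   moves along single coordinates that stay in the ball. *)
Lemma affine_of_partials_const (R : realType) (n : nat) (f : 'rV[R]_n -> R)
    (a : 'rV[R]_n) (r : R) (c : 'I_n -> R) :
  (forall u i, ball a r u -> is_derive u (delta_mx 0 i) f (c i)) ->
  forall u, ball a r u -> f u = f a + \sum_i (u 0 i - a 0 i) * c i.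
Proof.
move=> df u [r0 aru].
pose w m : 'rV[R]_n := \row_i (if (i < m)%N then u 0 i else a 0 i).
have aw0 : w 0%N = a by apply/rowP => i; rewrite mxE.
have uwn : w n = u by apply/rowP => i; rewrite mxE ltn_ord.
suff H m : (m <= n)%N ->
    f (w m) = f a + \sum_(i < n | (i < m)%N) (u 0 i - a 0 i) * c i.
  rewrite -uwn H// uwn; congr (_ + _); apply: eq_bigl => i; exact: ltn_ord.
elim: m => [|m IH] mn; first by rewrite aw0 big1 ?addr0.
pose i := Ordinal mn.
have -> : w m.+1 = w m + (u 0 i - a 0 i) *: delta_mx 0 i.
  apply/rowP => j; rewrite !mxE ltnS leq_eqVlt eqxx /=.
  have [->|ji] := eqVneq j i; first by rewrite eqxx ltnn mulr1 addrC subrK.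
  by rewrite (negbTE (ji : nat_of_ord j != m)) mulr0 addr0.
have bi : `|u 0 i - a 0 i| < r by have := aru 0 i; rewrite /ball /= distrC.
rewrite (@affine_of_derive_const R (fun t => f (w m + t *: delta_mx 0 i))
  (c i) r _ _ bi); last first.
  move=> t tr; apply: is_derive_line; apply: df; split=> // k j.
  rewrite ord1 !mxE /ball /=.
  (* Coordinate [i] of [w m] is still that of [a], so after the move it lies at distance [|t| < r]
     from it. *)
  have [->|ji] := eqVneq j i.
    by rewrite ltnn mulr1 opprD addrA subrr sub0r normrN.
  rewrite mulr0 addr0; case: ifP => _; last by rewrite subrr normr0.
  exact: (aru 0 j).
rewrite scale0r addr0 IH ?(ltnW mn)// -addrA; congr (_ + _).
rewrite [RHS](bigD1 i)//= addrC; congr (_ + _); apply: eq_bigl => j.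
by rewrite ltnS -val_eqE /= ltn_neqAle andbC.
Qed.

(** * Smoothness on open sets, charts and changes of affine coordinates *)

Lemma iter_derive_eq_in (R : realType) (V W : normedModType R) (B : set V)
    (f g : V -> W) (vs : seq V) :
  open B -> {in B, f =1 g} -> {in B, iter_derive vs f =1 iter_derive vs g}.
Proof.
move=> Bo fg; elim: vs => [//|v vs IH] a aB /=.
apply: near_eq_derive.
have: \near a, B a by apply: open_nbhs_nbhs; split => //; exact: set_mem.
by apply: filterS => u Bu; apply: IH; exact: mem_set.
Qed.

(** Near a point of an open [A] the local extension [F] coincides with [f], hence so do their
    iterated derivatives. *)
Lemma smooth_on_openE (R : realType) (V W : normedModType R) (A : set V)
    (f : V -> W) : open A -> smooth_on A f -> smooth_on_open A f.
Proof.
move=> Ao fsm vs a Aa; have [B [F [Bo Ba Fs FE]]] := fsm a Aa.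
have [Fc Fd] := Fs vs a Ba.
have BAo : open (B `&` A) by exact: openI.
have E : {in B `&` A, iter_derive vs F =1 iter_derive vs f}.
  exact: iter_derive_eq_in.
have nE : {near a, iter_derive vs F =1 iter_derive vs f}.
  have: \near a, (B `&` A) a by exact: open_nbhs_nbhs.
  by apply: filterS => u BAu; apply: E; exact: mem_set.
split=> [|v]; last exact: (near_eq_derivable nE).
rewrite /prop_for /continuous_at -E; last exact: mem_set.
apply: cvg_trans Fc; exact: near_eq_cvg nE.
Qed.

Section Charts.
Context (R : realType) (n : nat) (M : smoothManifold R n).
Implicit Types (x y : chart R n M) (p q : M) (u : 'rV[R]_n).

Lemma cimg_dom x u : cimg x u -> cdom x (cinv x u).
Proof. by move=> [q xq <-]; rewrite cmapK//; exact: mem_set. Qed.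

Lemma cinvK x u : cimg x u -> cmap x (cinv x u) = u.
Proof. by move=> [q xq <-]; rewrite cmapK//; exact: mem_set. Qed.

Lemma cmap_inj x p q : cdom x p -> cdom x q -> cmap x p = cmap x q -> p = q.
Proof.
by move=> /mem_set xp /mem_set xq /(congr1 (cinv x)); rewrite !cmapK.
Qed.

Lemma cimg_cmap x p : cdom x p -> cimg x (cmap x p).
Proof. by move=> xp; exists p. Qed.

Lemma near_cimg x u : cimg x u -> \near u, cimg x u.
Proof. by move=> xu; apply: open_nbhs_nbhs; split=> //; exact: cimg_open. Qed.

(** This is the part of [cimg x] that the continuous [cinv x] sends into the open set [cdom y]. *)
Lemma open_overlap x y : open (cmap x @` (cdom x `&` cdom y)).
Proof.
rewrite openE => _ [q [xq yq] <-].
have xu := cimg_cmap xq.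
have yn : \forall u \near cmap x q, cdom y (cinv x u).
  apply: (cinv_continuous (mem_set xu)); apply: open_nbhs_nbhs.
  by split; [exact: cdom_open | rewrite cmapK//; exact: mem_set].
apply: filterS2 (near_cimg xu) yn => u ux uy.
by exists (cinv x u); [split=> //; exact: cimg_dom | exact: cinvK].
Qed.

Lemma open_chart_preimage x (B : set 'rV[R]_n) :
  open B -> open (cdom x `&` cmap x @^-1` B).
Proof.
move=> Bo; rewrite openE => q [xq Bq].
apply: filterI; first by apply: open_nbhs_nbhs; split=> //; exact: cdom_open.
by apply: (cmap_continuous (mem_set xq)); exact: open_nbhs_nbhs.
Qed.

(** The constant [k] cancels in the difference quotients, and agreement on [cdom x] is agreement
    near [cmap x p] since chart images are open. *)
Lemma cpartialD_eq x i (f g : M -> R) (k : R) p : cdom x p ->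
  (forall q, cdom x q -> f q = k + g q) -> cpartial x i f p = cpartial x i g p.
Proof.
move=> xp fg; rewrite /cpartial.
have -> : 'D_(delta_mx 0 i) (g \o cinv x) (cmap x p) =
          'D_(delta_mx 0 i) (fun u => k + g (cinv x u)) (cmap x p).
  rewrite /derive; set F1 := (F in lim (F @ _) = _).
  set F2 := (F in _ = lim (F @ _)).
  suff -> : F1 = F2 by []; apply/funext => h.
  by rewrite /F1 /F2 /= opprD addrACA subrr add0r.
apply: near_eq_derive.
by apply: filterS (near_cimg (cimg_cmap xp)) => u xu; apply: fg; exact: cimg_dom.
Qed.

Lemma cpartial_eq x i (f g : M -> R) p : cdom x p ->
  (forall q, cdom x q -> f q = g q) -> cpartial x i f p = cpartial x i g p.
Proof.
by move=> xp fg; apply: (@cpartialD_eq _ _ _ _ 0) => // q /fg; rewrite add0r.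
Qed.

Lemma cpartial_scale x i (c : R) (f : M -> R) p : c != 0 ->
  cpartial x i (fun q => c * f q) p = c * cpartial x i f p.
Proof. exact: derive_scale. Qed.

Variable nabla : connection M.

(** Constancy of partial derivatives is integrated twice on a ball: vanishing second partials make
    the first partials of [H] constant, and constant first partials make [H] affine. *)
Lemma affine_chart_change x y p : affine_chart nabla x -> affine_chart nabla y ->
  cdom x p -> cdom y p ->
  exists (U : set M) (A : 'M[R]_n) (b : 'rV[R]_n),
    [/\ open U, U p, U `<=` cdom x `&` cdom y &
        forall q, U q -> cmap y q = cmap x q *m A + b].
Proof.
move=> [ax Gx] [ay Gy] xp yp.
set W := cmap x @` (cdom x `&` cdom y); pose H := cmap y \o cinv x.
pose h k u := H u 0 k; pose e j : 'rV[R]_n := delta_mx 0 j.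
have Wo : open W by exact: open_overlap.
have Hs : smooth_on_open W H.
  by apply: smooth_on_openE => //; have [] := atlas_compatible ax ay.
have Wn u : W u -> \near u, W u by move=> Wu; apply: open_nbhs_nbhs.
have WI : W `<=` cimg x by move=> _ [q [xq _] <-]; exact: cimg_cmap.
have dh k v u : W u -> derivable (h k) u v.
  by move=> Wu; have [_ /(_ v)/derivable_mxP] := Hs [::] u Wu; exact.
have Dh k v u : W u -> 'D_v (h k) u = 'D_v H u 0 k.
  by move=> Wu; rewrite derive_mx ?mxE//; have [_] := Hs [::] u Wu; exact.
(* Derivability comes from the smoothness of [H], the value 0 from the transformation law with both
   sets of Christoffel symbols zero. *)
have ddh k i j u : W u -> is_derive u (e i) ('D_(e j) (h k)) 0.
  move=> Wu; split.
    apply: (@near_eq_derivable _ _ _ (fun u => 'D_(e j) H u 0 k)).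
      by apply: filterS (Wn u Wu) => v Wv; rewrite Dh.
    by have [_ /(_ (e i))/derivable_mxP] := Hs [:: e j] u Wu; exact.
  have [q [xq yq] qu] := Wu.
  have := christoffel_change nabla i j k ax ay xq yq.
  rewrite big1 => [|m _]; last by rewrite Gx// mul0r.
  rewrite [X in _ + X]big1 ?addr0 => [|l _]; last first.
    by rewrite big1// => m _; rewrite Gy// !mul0r.
  rewrite /cpartial qu => ->; apply: near_eq_derive.
  by apply: filterS (Wn u Wu) => v /WI xv; rewrite /= cinvK.
set a := cmap x p.
have Wa : W a by exists p.
have [r r0 rW] : exists2 r : R, 0 < r & ball a r `<=` W.
  by have /nbhs_ballP[r /= r0 rW] := Wn a Wa; exists r.
pose A := \matrix_(j, k) 'D_(e j) (h k) a.
have DA j k u : ball a r u -> 'D_(e j) (h k) u = A j k.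
  move=> au; rewrite mxE.
  rewrite (@affine_of_partials_const R n ('D_(e j) (h k)) a r (fun=> 0) _ u au).
    by rewrite big1 ?addr0// => i _; rewrite mulr0.
  by move=> v i /rW Wv; exact: ddh.
have HA u : ball a r u -> H u = u *m A + (H a - a *m A).
  move=> au; apply/rowP => k.
  rewrite -[LHS]/(h k u).
  rewrite (@affine_of_partials_const R n (h k) a r (fun j => A j k) _ u au);
    last first.
    by move=> v j av; split; [exact/dh/rW | exact: DA].
  rewrite addrCA -mulmxBl [RHS]mxE; congr (_ + _); rewrite mxE.
  by apply: eq_bigr => j _; rewrite !mxE.
exists (cdom x `&` cmap x @^-1` ball a r), A, (H a - a *m A); split.
- by apply: open_chart_preimage; exact: ball_open.
- by split=> //; exact: ballxx.
(* The point [cmap x q] of [W] comes from some [q'] in the overlap, and injectivity of the chart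
   gives [q = q']. *)
- move=> q [xq /rW [q' [xq' yq'] qq']]; split=> //.
  by rewrite (cmap_inj xq xq').
- by move=> q [xq aq]; rewrite -HA// /H /= cmapK//; exact: mem_set.
Qed.

End Charts.

(** * Constant scaling of metrics and Koszul forms, and the identity family *)

Section Scaling.
Context (R : realType) (n : nat) (M : smoothManifold R n).
Variable nabla : connection M.
Implicit Types (g b : tensor2 M) (c : R).

Lemma pullback_scale x y (phi : M -> M) c g p :
  pullback x y phi (fun x p => c *: g x p) p = c *: pullback x y phi g p.
Proof. by rewrite /pullback -scalemxAr -scalemxAl. Qed.

Lemma is_tensor2_scale c g : is_tensor2 g -> is_tensor2 (fun x p => c *: g x p).
Proof.
move=> [gs gp]; split=> [x ax|x y p ax ay xp yp].
  exact: (smooth_on_scale c (gs x ax)).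
by rewrite pullback_scale -gp.
Qed.

Lemma is_symmetric_scale c g :
  is_symmetric g -> is_symmetric (fun x p => c *: g x p).
Proof. by move=> gs x p ax xp; rewrite linearZ /= gs. Qed.

Lemma riemannian_scale c g :
  0 < c -> riemannian g -> riemannian (fun x p => c *: g x p).
Proof.
move=> c0 [gt gs gp]; split; first exact: is_tensor2_scale.
  exact: is_symmetric_scale.
move=> x p v ax xp v0; rewrite -scalemxAr -scalemxAl mxE.
by rewrite mulr_gt0// gp.
Qed.

Lemma hess_scale c (f : M -> R) x p : c != 0 ->
  hess nabla (fun q => c * f q) x p = c *: hess nabla f x p.
Proof.
move=> c0; apply/matrixP => i j; rewrite !mxE mulrBr; congr (_ - _).
  rewrite -cpartial_scale//; congr cpartial; apply/funext => q.
  exact: cpartial_scale.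
rewrite mulr_sumr; apply: eq_bigr => k _.
by rewrite cpartial_scale// mulrCA.
Qed.

Lemma hessian_metric_scale c g :
  0 < c -> hessian_metric nabla g -> hessian_metric nabla (fun x p => c *: g x p).
Proof.
move=> c0 [gr gh]; split; first exact: riemannian_scale.
move=> p; have [U [f [Uo Up fs gf]]] := gh p.
exists U, (fun q => c * f q); split=> //.
  by move=> x ax; exact: (smooth_on_scale c (fs x ax)).
by move=> x q ax Uq xq; rewrite hess_scale ?gt_eqF// -gf.
Qed.

Lemma second_koszul_form_scale c g b : 0 < c -> riemannian g ->
  second_koszul_form nabla g b ->
  second_koszul_form nabla (fun x p => c *: g x p) b.
Proof.
move=> c0 [_ _ gp] [bt bs bE]; split; [exact: bt | exact: bs |].
move=> x p i j ax xp.
rewrite (bE x p i j ax xp); congr (2^-1 * _).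
apply: (cpartial_eq _ xp) => q xq.
(* The shift comes from [\det (c *: G) = c ^+ n * \det G] and already vanishes in the inner
   derivative; [ln] splits because both factors are positive. *)
apply/esym/(@cpartialD_eq _ _ _ _ _ _ _ (ln (c ^+ n)) _ xq) => q' xq'.
rewrite detZ lnM// posrE ?exprn_gt0//.
by apply: posdef_det_gt0 => v v0; apply: gp => //; case: ax.
Qed.

(** In charts this family is a transition map composed with the projection that forgets time. *)
Lemma smooth_family_id (I : set R) : smooth_family I (fun (_ : R) (p : M) => p).
Proof.
split.
  by apply: continuous_subspaceT => z; exact: cvg_snd.
move=> x y ax ay; have [xy _] := atlas_compatible ax ay.
apply: smooth_on_snd xy => -[t u] /= [_ xu yu].
by exists (cinv x u); [split=> //; exact: cimg_dom | exact: cinvK].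
Qed.

Lemma affine_map_id : affine_map nabla (fun p : M => p).
Proof. by move=> p x y ax ay xp yp; exact: affine_chart_change ax ay xp yp. Qed.

End Scaling.

(** For [s != t] the difference quotient is exactly [a *: w], so the limit holds on any [I],
    one-sided at time 0 included. *)
Lemma has_derivative_within_affine_scale (R : realType) (W : normedModType R)
    (I : set R) (a t : R) (w : W) :
  has_derivative_within I (fun s => (1 + a * s) *: w) t (a *: w).
Proof.
apply: cvg_near_cst; rewrite near_withinE; near=> s => _.
have st : s - t != 0 by rewrite subr_eq0; near: s; exact: nbhs_dnbhs_neq.
rewrite -scalerBl opprD addrACA subrr add0r -mulrBr scalerA.
by rewrite mulrCA mulVf ?mulr1.
Unshelve. all: by end_near.
Qed.

Theorem theorem4p2 (R : realType) (n : nat) (M : smoothManifold R n)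
    (nabla : connection M) (hnabla : flat_connection nabla)
    (g0 : tensor2 M) (hg0 : hesse_einstein nabla g0) :
  exists (T : \bar R) (g : R -> tensor2 M),
    koszul_soliton nabla T g /\ tensor2_eq (g 0%R) g0.
Proof.
have [gh [lambda kg]] := hg0.
pose sigma (t : R) := 1 + 2 * lambda * t.
have sigma0 : sigma 0 = 1 by rewrite /sigma mulr0 addr0.
(* This time serves both signs of [lambda]: [t < T] forces [|2 * lambda| * t < 1]. The summand 1
   keeps the denominator positive when [lambda = 0]. *)
pose T : R := (1 + `|2 * lambda|)^-1.
have N0 : 0 < 1 + `|2 * lambda| by rewrite ltr_pwDl.
have sigma_gt0 t : time_interval T%:E t -> 0 < sigma t.
  move=> [t0]; rewrite lte_fin /T -div1r ltr_pdivlMr// => tT.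
  have : - (2 * lambda * t) < 1; last by rewrite -subr_gt0 opprK.
  rewrite (le_lt_trans (ler_norm _))// normrN normrM (ger0_norm t0).
  by rewrite (le_lt_trans _ tT)// mulrDr mulr1 mulrC lerDr.
pose g t : tensor2 M := fun x p => sigma t *: g0 x p.
have g0E : g 0 = g0.
  by apply/funext => x; apply/funext => p; rewrite /g sigma0 scale1r.
have flow : hesse_koszul_flow nabla T%:E (g 0) g.
  split=> //.
  - by rewrite lte_fin invr_gt0.
  - by move=> t /sigma_gt0 st; exact: hessian_metric_scale.
  (* The Koszul form does not see the factor [sigma t], so at every time it is [lambda *: g0], with
     the initial metric. *)
  - move=> t tT; exists (fun x p => lambda *: g0 x p).
      by apply: second_koszul_form_scale kg; [exact: sigma_gt0 | case: gh].
    move=> x p ax xp; rewrite scalerA.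
    exact: has_derivative_within_affine_scale.
exists T%:E, g; split; last by rewrite g0E.
split=> //; exists sigma, (fun _ p => p); split.
- by split=> //; exact: smooth_on_affine.
- by split=> //; exact: smooth_family_id.
- by move=> t _; split; [exists id | exact: affine_map_id].
(* Pulling back by the identity between two charts is the tensor transformation law of [g0]. *)
- move=> t x y p _ ax ay xp yp; rewrite g0E.
  by have [[[_ gp] _ _] _] := gh; rewrite -gp.
Qed.
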